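(* Let $T$ be a finite tree with $n$ simplices (vertices plus edges), and let $D$ be a persistence diagram consistent with $T$. Then there exists a discrete Morse function $f\colon T\to[0,n]$ whose induced (degree-$0$) persistence diagram satisfies $D_f=D$.
   Context: For a finite simple graph $G$, its simplices are its vertices and edges; write $v<e$ if vertex $v$ is an endpoint of edge $e$. Let $n$ be the total number of simplices. A discrete Morse function is a function $f$ from the set of simplices of $G$ to $[0,n]$ such that: (i) $v<e$ implies $f(v)\le f(e)$; (ii) $\min f=0$; (iii) every value is attained by at most two simplices, and if $f(\sigma)=f(\tau)$ with $\sigma\neq\tau$ then one of $\sigma,\tau$ is an endpoint of the other; (iv) if a value $f(\sigma)$ is attained only by $\sigma$, then $f(\sigma)\in\mathbb{N}$. Such $\sigma$ is called critical and $f(\sigma)$ a critical value. For $a\in\mathbb{R}$ the level subcomplex is $G_a=\{\sigma: f(\sigma)\le a\}$ (a subgraph). If $c_0<c_1<\dots<c_{m-1}$ are the critical values, $f$ induces the filtration $G_{c_0}\subseteq\dots\subseteq G_{c_{m-1}}$, and its persistent homology (over a field) gives a persistence diagram $D_f$: the multiset of pairs (birth value, death value) of homology classes, with death value $\infty$ for classes that never die. For a tree only degree-$0$ homology occurs. A persistence diagram $D=\{(c_i,d_i)\}$ (a finite set of pairs) is consistent with a tree $T$ on $n$ simplices if $(0,\infty)\in D$ and for all $c_i,d_j$ occurring in pairs of $D\setminus\{(0,\infty)\}$: $c_i,d_j\in\mathbb{Z}$; $1\le c_i,d_j\le n$; $c_i<d_i$ and $c_i<c_j$ for $i<j$; and all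 the numbers $c_i,d_j$ are pairwise distinct. *)

(* Defs.v *)
From HB Require Import structures.
From mathcomp Require Import all_boot all_order all_algebra.
Set Implicit Arguments. Unset Strict Implicit. Unset Printing Implicit Defensive.
Import Order.TTheory GRing.Theory Num.Theory.
Local Open Scope ring_scope.

Definition simple_graph (V : finType) (e : rel V) : Prop :=
  symmetric e /\ irreflexive e.

Definition acyclic (V : finType) (e : rel V) : Prop :=
  forall c : seq V, (3 <= size c)%N -> ~~ (cycle e c && uniq c).

Definition is_tree (V : finType) (e : rel V) : Prop :=
  [/\ simple_graph e, (0 < #|V|)%N, (forall x y, connect e x y) & acyclic e].

(* Simplices live in V + {set V}: inl v is the vertex v, inr s is the edge s
   (a 2-element set {x,y} with e x y). *)
Definition simplex (V : finType) (e : rel V) (s : V + {set V}) : bool :=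
  match s with
  | inl _ => true
  | inr s => [exists x, exists y, e x y && (s == [set x; y])]
  end.

Definition face (V : finType) (s t : V + {set V}) : bool :=
  match s, t with
  | inl v, inr t => v \in t
  | _, _ => false
  end.

Definition nsimp (V : finType) (e : rel V) : nat := #|[pred s | simplex e s]|.

Section DMF.
Variables (V : finType) (e : rel V) (R : realFieldType).
Implicit Types (f : V + {set V} -> R) (s t u : V + {set V}).

Definition critical f s : bool :=
  simplex e s && [forall t, simplex e t ==> (f t == f s) ==> (t == s)].

Definition discrete_Morse f : Prop :=
  [/\
      (forall s, simplex e s -> 0 <= f s <= (nsimp e)%:R),
      (forall s t, simplex e s -> simplex e t -> face s t -> f s <= f t),
      (exists2 s, simplex e s & f s = 0),
      (forall s t u, simplex e s -> simplex e t -> simplex e u ->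
         s != t -> t != u -> s != u -> ~ (f s = f t /\ f t = f u)) /\
      (forall s t, simplex e s -> simplex e t -> s != t -> f s = f t ->
         face s t || face t s)
    &
      (forall s, critical f s -> exists k : nat, f s = k%:R)].

Definition crit_values f : seq R :=
  sort <=%R [seq f s | s <- enum [pred s | critical f s]].

Variable F : fieldType.

Definition vdelta (v : V) : 'rV[F]_#|V| := delta_mx 0 (enum_rank v).

(* C_0(G_a) inside the vertex space F^V *)
Definition cycles0 f (a : R) : 'M[F]_#|V| :=
  (\sum_(v | (f (inl v) <= a)%R) <<vdelta v>>)%MS.

(* B_0(G_a) = image of the boundary map of the edges of G_a *)
Definition bound0 f (a : R) : 'M[F]_#|V| :=
  (\sum_(x : V) \sum_(y : V | e x y && (f (inr [set x; y]) <= a)%R)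
      <<vdelta x - vdelta y>>)%MS.

(* rank of H_0(G_a) -> H_0(G_b), for a <= b:
   dim ((C_0(G_a) + B_0(G_b)) / B_0(G_b)) *)
Definition pbetti f (a b : R) : int :=
  (\rank (cycles0 f a + bound0 f b)%MS)%:Z - (\rank (bound0 f b))%:Z.

Definition betaI f (i j : nat) : int :=
  pbetti f (crit_values f)`_i (crit_values f)`_j.
(* index i-1, with beta^{-1,j} = 0 *)
Definition betaP f (i j : nat) : int :=
  if i is i'.+1 then betaI f i' j else 0.

Definition pmult f (i j : nat) : int :=
  (betaI f i j.-1 - betaI f i j) - (betaP f i j.-1 - betaP f i j).
Definition pmult_inf f (i : nat) : int :=
  betaI f i (size (crit_values f)).-1 - betaP f i (size (crit_values f)).-1.

(* The persistence diagram D_f, as a multiplicity function on pairs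
   (birth, death), death = None meaning infinity. *)
Definition pd_mult f (p : R * option R) : int :=
  let cs := crit_values f in
  let m := size cs in
  \sum_(i < m) \sum_(j < m | (i < j)%N)
      (if p == (cs`_i, Some cs`_j) then pmult f i j else 0)
  + \sum_(i < m) (if p == (cs`_i, None) then pmult_inf f i else 0).

End DMF.

(* A diagram: a finite set (uniq seq) of pairs (birth, death); death None = oo.
   Entries are naturals (consistency forces integers >= 0). *)
Definition consistent (n : nat) (D : seq (nat * option nat)) : Prop :=
  [/\ (0%N, None) \in D,
      uniq D,
      (forall p, p \in D -> p != (0%N, None) ->
         exists2 d, p.2 = Some d & [/\ (1 <= p.1)%N, (p.1 < d)%N & (d <= n)%N])
    & uniq (flatten [seq [:: p.1; odflt 0%N p.2] | p <- D & p != (0%N, None)])].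

Definition diag_to_R (R : realFieldType) (D : seq (nat * option nat))
  : seq (R * option R) :=
  [seq (p.1%:R, omap (fun d : nat => d%:R) p.2) | p <- D].

(* Main.v *)
(** List the vertices as v_0, v_1, ... so that each v_i with i > 0 has exactly
    one neighbour par(v_i) among the earlier ones, and sort the finite bars
    (c_1, d_1), ..., (c_k, d_k) of D by birth.  Put f(v_0) = 0, and for
    1 <= i <= k give v_i the value c_i and the edge {v_i, par(v_i)} the value
    d_i; every later v_i shares a non-integral value with its edge.  Counting
    simplices gives k < #|V|, so there is room for all the bars.

    The vectors u_0 = [v_0], u_i = [v_i] - [par(v_i)] form a basis of C_0(T) in
    which both C_0(T_a) and B_0(T_b) are spanned by basis vectors, since f
    increases with i on vertices.  Hence the persistent Betti number
    beta^{a,b} counts the i such that f(v_i) <= a and not (i > 0 and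
    f({v_i, par(v_i)}) <= b), that is, the bars are exactly the pairs
    (f(v_i), f({v_i, par(v_i)})), those with equal entries being invisible. *)

Require Import Defs.
From HB Require Import structures.
From mathcomp Require Import all_boot all_order all_algebra.
Set Implicit Arguments. Unset Strict Implicit. Unset Printing Implicit Defensive.
Import Order.TTheory GRing.Theory Num.Theory.
Local Open Scope ring_scope.

(** * Enumerating a tree so that each vertex but the first has one earlier neighbour *)

Lemma connected_enumeration (V : finType) (e : rel V) (v0 : V) :
  (forall x y, connect e x y) ->
  exists s : seq V, [/\ uniq s, s =i predT &
    forall v, v \in s -> (0 < index v s)%N ->
      exists2 u, e u v & (index u s < index v s)%N].
Proof.
move=> conn.
have grow n : (0 < n <= #|V|)%N -> exists s : seq V, [/\ uniq s, size s = n &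
    forall v, v \in s -> (0 < index v s)%N ->
      exists2 u, e u v & (index u s < index v s)%N].
  elim: n => // -[_ _|n IH /andP[_ ltn]].
    by exists [:: v0]; split=> // v; rewrite inE => /eqP ->; rewrite /= eqxx.
  have [//|s [us ss hs]] := IH; first by rewrite /= ltnW.
  have [x xs] : exists x, x \in s.
    by case: s ss {us hs} => // x s _; exists x; rewrite mem_head.
  have [y yNs] : exists y, y \notin s.
    apply/existsP; rewrite -[X in is_true X]negbK negb_exists.
    apply/negP => /forallP all_s.
    suff : (#|V| <= n.+1)%N by rewrite leqNgt ltn.
    rewrite -ss -(card_uniqP us); apply/subset_leq_card/subsetP => z _.
    by rewrite -[_ \in _]negbK all_s.
  (* A path from a listed vertex to an unlisted one must leave the list along some edge; the far end
     of that edge is appended. *)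
  have [u [v [us_ vNs euv]]] : exists u v, [/\ u \in s, v \notin s & e u v].
    have /connectP[p] := conn x y.
    elim: p x xs => [|z p IHp] x xs /=; first by move=> _ yx; rewrite yx xs in yNs.
    case/andP=> exz pzp lasty; have [zs|zNs] := boolP (z \in s).
      exact: (IHp z).
    by exists x, z.
  exists (rcons s v); split; rewrite ?rcons_uniq ?vNs ?size_rcons ?ss //.
  have idx_rcons w : w \in s -> index w (rcons s v) = index w s.
    by move=> ws; rewrite -cats1 index_cat ws.
  move=> w; rewrite mem_rcons inE => /orP[/eqP ->|ws].
    move=> _; exists u => //; rewrite idx_rcons // -cats1 index_cat (negPf vNs) /=.
    by rewrite eqxx addn0 index_mem.
  rewrite idx_rcons // => /(hs w ws)[t etw ltw]; exists t => //.
  by rewrite idx_rcons // -index_mem (ltn_trans ltw) ?index_mem.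
have [|s [us ss hs]] := grow #|V|.
  by rewrite leqnn andbT; apply/card_gt0P; exists v0.
exists s; split=> // v.
have sub_enum : {subset s <= enum V} by move=> w _; rewrite mem_enum.
by have [|_ ->] := uniq_min_size us sub_enum; rewrite ?mem_enum // -cardE ss.
Qed.

(** Connectedness gives an earlier neighbour, acyclicity its uniqueness: two earlier neighbours of
    [x] are joined through the root by vertices earlier than [x], and together with [x] they would
    close a cycle. *)
Lemma tree_order (V : finType) (e : rel V) : is_tree e ->
  exists (idx : V -> nat) (par : V -> V),
  [/\ injective idx, (forall v, (idx v < #|V|)%N),
      (forall v, (0 < idx v)%N -> e v (par v) /\ (idx (par v) < idx v)%N) &
      (forall x y, e x y -> (idx y < idx x)%N -> y = par x)].
Proof.
case=> -[esym _] /card_gt0P[v0 _] conn acyc.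
have [s [us ins hs]] := connected_enumeration v0 conn.
pose idx v := index v s.
have idx_inj : injective idx by move=> x y; apply: index_inj; rewrite ?ins.
have ex_par v : (0 < idx v)%N -> exists2 u, e u v & (idx u < idx v)%N.
  by apply: hs; rewrite ins.
(* The subgraph induced on the vertices of index below [i]; passing repeatedly to an earlier
   neighbour stays inside it and ends at the root. *)
pose e' i := [rel u v | [&& e u v, idx u < i & idx v < i]%N].
have e'sym i : connect_sym (e' i).
  by apply: sym_connect_sym => u v /=; rewrite esym; congr (_ && _); rewrite andbC.
have e'root i n u : (idx u = n)%N -> (n < i)%N ->
    exists2 w, connect (e' i) u w & idx w = 0%N.
  elim/ltn_ind: n u => n IH u un ltni.
  have [u0|] := posnP (idx u); first by exists u.
  move=> /ex_par[t etu lttu]; have [||w ctw w0] := IH (idx t) _ t erefl.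
  - by rewrite -un.
  - by rewrite (ltn_trans lttu) // un.
  exists w => //; apply: connect_trans ctw; apply: connect1 => /=.
  by rewrite esym etu un ltni (ltn_trans lttu) // un.
have uniq_par x y z : e x y -> e x z -> (idx y < idx x)%N -> (idx z < idx x)%N ->
    y = z.
  move=> exy exz ltyx ltzx.
  have cyz : connect (e' (idx x)) y z.
    have [w cyw w0] := e'root _ _ y erefl ltyx.
    have [w' czw w'0] := e'root _ _ z erefl ltzx.
    have ww : w = w' by apply: idx_inj; rewrite w0.
    by rewrite (connect_trans cyw) // e'sym ww.
  (* If [y] and [z] differ, a simple path between them among the vertices earlier than [x] has at
     least two vertices, so adding [x] yields a cycle of length at least 3. *)
  have /connectP[p0 p0P] := cyz; case/shortenP: p0P => p pP up _ lastp.
  case: p pP up lastp => [//|t p] pP up lastp; exfalso.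
  have : ~~ (cycle e [:: x, y, t & p] && uniq [:: x, y, t & p]) by apply: acyc.
  move/negP; apply; apply/andP; split.
    rewrite -[cycle _ _]/(path e x (rcons (y :: t :: p) x)).
    rewrite -cats1 cat_path /= exy.
    have := sub_path (e' := e) _ pP; move/(_ (fun u v h => proj1 (andP h))) => /= ->.
    by rewrite /= in lastp; rewrite -lastp esym exz.
  rewrite cons_uniq up andbT; apply/negP => xin.
  have below q b : path (e' (idx x)) b q -> all (fun u => idx u < idx x)%N q.
    by elim: q b => //= c q IH b /andP[/and3P[_ _ ->]] /IH.
  have : all (fun u => idx u < idx x)%N (y :: t :: p).
    by apply/andP; split; [exact: ltyx | exact: below pP].
  by move/allP/(_ x xin); rewrite ltnn.
(* The default [x] is taken exactly at the root, which has no earlier neighbour. *)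
pose par x := odflt x [pick y | e x y && (idx y < idx x)%N].
exists idx, par; split=> //.
- have size_s : size s = #|V| by rewrite -(card_uniqP us); apply: eq_card.
  by move=> v; rewrite -size_s index_mem ins.
- move=> v /ex_par[u euv ltuv]; rewrite /par.
  case: pickP => [y /andP[] //|/(_ u)]; by rewrite esym euv ltuv.
- move=> x y exy ltyx; rewrite /par; case: pickP => [z /andP[exz ltzx]|/(_ y)] /=.
    exact: uniq_par exy exz ltyx ltzx.
  by rewrite exy ltyx.
Qed.

(** * The basis of the vertex space adapted to a rooted tree *)

Section RootedBasis.
Variables (V : finType) (idx : V -> nat) (par : V -> V) (F : fieldType).
Hypothesis ltn_par : forall v, (0 < idx v)%N -> (idx (par v) < idx v)%N.
Hypothesis idx_inj : injective idx.

Definition rooted_vec (v : V) : 'rV[F]_#|V| :=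
  if (0 < idx v)%N then vdelta F v - vdelta F (par v) else vdelta F v.

Definition rooted_span (P : pred V) : 'M[F]_#|V| :=
  (\sum_(v | P v) <<rooted_vec v>>)%MS.

Lemma rooted_vec_sub (P : pred V) v : P v -> (rooted_vec v <= rooted_span P)%MS.
Proof. by move=> Pv; rewrite (sumsmx_sup v) // genmxE. Qed.

(** Telescoping down to the root: a non-root [vdelta v] is [rooted_vec v] plus [vdelta (par v)], and
    closure of [P] under [par] keeps every term in the span. *)
Lemma vdelta_sub_rooted_span (P : pred V) :
  (forall v, P v -> (0 < idx v)%N -> P (par v)) ->
  forall v, P v -> (vdelta F v <= rooted_span P)%MS.
Proof.
move=> parP v; have [n] := ubnP (idx v); elim: n v => // n IH v.
rewrite ltnS => lvn Pv; have := rooted_vec_sub Pv; rewrite /rooted_vec.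
case: ifP => // v_gt0 subP.
rewrite -[vdelta F v](subrK (vdelta F (par v))) addmx_sub ?IH ?parP //.
exact: leq_trans (ltn_par v_gt0) lvn.
Qed.

(** Independence by counting: a span has rank at most the number of its generators, while [P] and
    its complement together span the whole space, of dimension [#|V|]. *)
Lemma rank_rooted_span (P : pred V) : \rank (rooted_span P) = #|P|.
Proof.
have le_card Q : (\rank (rooted_span Q) <= #|Q|)%N.
  rewrite /rooted_span -sum1_card.
  apply: (big_ind2 (fun (A : 'M_#|V|) n => (\rank A <= n)%N)) => [|A m B n leA leB|v _].
  - by rewrite mxrank0.
  - exact: leq_trans (mxrank_adds_leqif A B) (leq_add leA leB).
  - by rewrite genmxE rank_leq_row.
have full : \rank (rooted_span predT) = #|V|.
  apply/eqP; rewrite -[_ == _]/(row_full _) -sub1mx; apply/row_subP => i.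
  rewrite row1 -[i]enum_valK.
  exact: (@vdelta_sub_rooted_span predT).
have splitT : (\rank (rooted_span predT)
    <= \rank (rooted_span P) + \rank (rooted_span (predC P)))%N.
  apply: leq_trans (mxrank_adds_leqif _ _); apply: mxrankS.
  apply/sumsmx_subP => v _; rewrite genmxE; have [Pv|NPv] := boolP (P v).
    by rewrite (submx_trans (rooted_vec_sub Pv)) ?addsmxSl.
  by rewrite (submx_trans (rooted_vec_sub (P := predC P) NPv)) ?addsmxSr.
apply/eqP; rewrite eqn_leq le_card -(leq_add2r #|predC P|) cardC.
by rewrite full in splitT; apply: leq_trans splitT _; rewrite leq_add2l le_card.
Qed.

Variables (e : rel V) (R : realFieldType) (f : V + {set V} -> R).
Hypothesis e_sym : symmetric e.
Hypothesis e_irr : irreflexive e.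
Hypothesis e_par : forall v, (0 < idx v)%N -> e v (par v).
Hypothesis par_uniq : forall x y, e x y -> (idx y < idx x)%N -> y = par x.
Hypothesis f_par :
  forall v, (0 < idx v)%N -> f (inl (par v)) <= f (inl v).

Lemma cycles0_rooted a :
  (cycles0 F f a :=: rooted_span [pred v | (f (inl v) <= a)%R])%MS.
Proof.
apply/eqmxP/andP; split; apply/sumsmx_subP => v /= fv; rewrite genmxE.
  apply: vdelta_sub_rooted_span => //= w fw w_gt0.
  exact: le_trans (f_par w_gt0) fw.
rewrite /rooted_vec; case: ifP => [v_gt0|_]; last first.
  by rewrite (sumsmx_sup v) // genmxE.
rewrite addmx_sub ?eqmx_opp //; first by rewrite (sumsmx_sup v) // genmxE.
by rewrite (sumsmx_sup (par v)) ?genmxE // (le_trans (f_par v_gt0)).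
Qed.

(** Every edge joins its later endpoint [v] to [par v], so its boundary is [rooted_vec v] up to
    sign. *)
Lemma bound0_rooted b :
  (bound0 e F f b :=: rooted_span
     [pred v | (0 < idx v)%N && (f (inr [set v; par v]) <= b)%R])%MS.
Proof.
apply/eqmxP/andP; split.
  apply/sumsmx_subP => x _; apply/sumsmx_subP => y /andP[exy fxy].
  rewrite genmxE.
  have aux u v : e u v -> f (inr [set u; v]) <= b -> (idx v < idx u)%N ->
      (vdelta F u - vdelta F v <= rooted_span
     [pred v | (0 < idx v)%N && (f (inr [set v; par v]) <= b)%R])%MS.
    move=> euv fuv ltvu; have vE := par_uniq euv ltvu.
    have u_gt0 : (0 < idx u)%N by apply: leq_ltn_trans ltvu.
    have := @rooted_vec_sub
      [pred v | (0 < idx v)%N && (f (inr [set v; par v]) <= b)%R] u.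
    by rewrite /rooted_vec /= u_gt0 -vE; apply.
  case: (ltngtP (idx x) (idx y)) => [ltxy|ltyx|/idx_inj xy].
  - by rewrite -opprB eqmx_opp aux // 1?e_sym // setUC.
  - exact: aux.
  - by rewrite xy e_irr in exy.
apply/sumsmx_subP => v /= /andP[v_gt0 fv]; rewrite genmxE /rooted_vec v_gt0.
rewrite (sumsmx_sup v) // (sumsmx_sup (par v)) ?genmxE //.
by rewrite e_par.
Qed.

(** With both spaces spanned by subsets [P] and [Q] of one basis, the sum is spanned by the union,
    and the difference of ranks counts [P] minus [Q]. *)
Lemma pbetti_rooted a b :
  pbetti e F f a b = #|[pred v | (f (inl v) <= a)%R &&
    ~~ ((0 < idx v)%N && (f (inr [set v; par v]) <= b)%R)]|%:Z.
Proof.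
rewrite /pbetti (adds_eqmx (cycles0_rooted a) (bound0_rooted b)) bound0_rooted.
set P := [pred v | _]; set Q := [pred v | _].
have -> : \rank (rooted_span P + rooted_span Q)%MS = #|predU P Q|.
  rewrite -[RHS]rank_rooted_span; apply: eqmx_rank; apply/andP; split.
    rewrite addsmx_sub; apply/andP; split; apply/sumsmx_subP => v Pv.
      by rewrite genmxE; apply: rooted_vec_sub; apply/orP; left.
    by rewrite genmxE; apply: rooted_vec_sub; apply/orP; right.
  apply/sumsmx_subP => v /orP[Pv|Qv]; rewrite genmxE.
    by rewrite (submx_trans (rooted_vec_sub Pv)) ?addsmxSl.
  by rewrite (submx_trans (rooted_vec_sub Qv)) ?addsmxSr.
rewrite rank_rooted_span -(cardID Q (predU P Q)) PoszD.
rewrite (eq_card (B := Q));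
  last by move=> v; rewrite !inE /=; case: (_ <= b)%R; case: (_ <= a)%R; case: (0 < _)%N.
rewrite addrC addKr; congr Posz; apply: eq_card => v.
by rewrite /P /Q !inE /=; case: (f (inl v) <= a)%R; case: (0 < idx v)%N;
   case: (f (inr _) <= b)%R.
Qed.

End RootedBasis.

(** * Reading the diagram off persistent Betti numbers that count bars *)

Section DiagramFromBars.
Variables (V : finType) (e : rel V) (R : realFieldType) (F : fieldType).
Variables (f : V + {set V} -> R) (birth : V -> R) (death : V -> option R).

Let cs := crit_values e f.

(** The inequality is strict because a class dying at [x] is already zero at level [x]. *)
Definition outlives (b : R) (d : option R) : bool :=
  if d is Some x then b < x else true.

Hypothesis cs_sorted : sorted <%R cs.
Hypothesis betaE : forall i j,
  betaI e F f i j =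
    #|[pred v | (birth v <= cs`_i)%R && outlives cs`_j (death v)]|%:Z.
Hypothesis bars : forall v,
  death v = Some (birth v) \/ birth v \in cs /\
  (if death v is Some d then d \in cs /\ birth v < d else True).

Let le_cs i j : (i < size cs)%N -> (j < size cs)%N -> (cs`_i <= cs`_j) = (i <= j)%N.
Proof. by move=> *; rewrite (lt_sorted_leq_nth 0). Qed.
Let lt_cs i j : (i < size cs)%N -> (j < size cs)%N -> (cs`_i < cs`_j) = (i < j)%N.
Proof. by move=> *; rewrite (lt_sorted_ltn_nth 0). Qed.

Let born v i : int := (birth v <= cs`_i)%R%:R.
Let bornP v i : int := if i is i'.+1 then born v i' else 0.
Let alive v j : int := (outlives cs`_j (death v))%:R.

Let betaI_sum i j : betaI e F f i j = \sum_v born v i * alive v j.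
Proof.
rewrite betaE -natz -sum1_card natr_sum big_mkcond; apply: eq_bigr => v _.
by rewrite /born /alive inE; case: (_ <= _); case: (outlives _ _); rewrite ?mul0r ?mulr0.
Qed.

Let betaP_sum i j : betaP e F f i j = \sum_v bornP v i * alive v j.
Proof. by case: i => [|i] /=; [rewrite big1 // => v _; rewrite mul0r | exact: betaI_sum]. Qed.

(** Since [betaI] is a sum over vertices of a birth indicator times a survival indicator, the double
    difference factors, vertex by vertex, into one difference in each index. *)
Let pmult_sum i j : pmult e F f i j =
  \sum_v (born v i - bornP v i) * (alive v j.-1 - alive v j).
Proof.
rewrite /pmult !betaI_sum !betaP_sum -!sumrB; apply: eq_bigr => v _.
by rewrite mulrBl !mulrBr.
Qed.

Let pmult_inf_sum i : pmult_inf e F f i =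
  \sum_v (born v i - bornP v i) * alive v (size cs).-1.
Proof.
rewrite /pmult_inf betaI_sum betaP_sum -sumrB; apply: eq_bigr => v _.
by rewrite mulrBl.
Qed.

Let born_step v b i : (b < size cs)%N -> (i < size cs)%N -> birth v = cs`_b ->
  born v i - bornP v i = (i == b)%:R.
Proof.
move=> ltb lti bE; rewrite /born bE le_cs //; case: i lti => [|i] lti /=.
  by rewrite leqn0 eq_sym subr0.
rewrite /born bE le_cs ?(ltnW lti) // leq_eqVlt ltnS [_ == b]eq_sym.
by case: eqVneq => [->|_]; rewrite ?ltnn ?subr0 ?subrr.
Qed.

(** The bound [0 < j] matters: at [j = 0] the truncated predecessor makes the difference vanish even
    when [d = 0]. *)
Let alive_step v d j : (d < size cs)%N -> (0 < j < size cs)%N ->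
  death v = Some cs`_d -> alive v j.-1 - alive v j = (j == d)%:R.
Proof.
case: j => // j ltd /= ltj dE; rewrite /alive dE /= !lt_cs ?(ltnW ltj) //.
by rewrite (leq_eqVlt j.+1); case: eqVneq => [->|_]; rewrite ?ltnn ?subr0 ?subrr.
Qed.

Let bar_contribution v p : int :=
  \sum_(i < size cs) \sum_(j < size cs | (i < j)%N)
      (if p == (cs`_i, Some cs`_j)
       then (born v i - bornP v i) * (alive v j.-1 - alive v j) else 0)
  + \sum_(i < size cs) (if p == (cs`_i, None)
       then (born v i - bornP v i) * alive v (size cs).-1 else 0).

(** For a bar of positive length the differences are Kronecker deltas at its birth and death
    indices, so one term survives. For a bar of length zero, whose ends need not be critical values,
    every product vanishes. *)
Let bar_contributionE v p : bar_contribution v p =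
  ((p == (birth v, death v)) && (death v != Some (birth v)))%:R.
Proof.
rewrite /bar_contribution; have [dE|[/(nthP 0)[b ltb bE] dP]] := bars v.
  rewrite dE eqxx andbF.
  (* Length zero: from the first index where the bar is born it is also dead, and before that index
     the birth difference is zero. *)
  have dead i j : (i < size cs)%N -> (j < size cs)%N -> (i <= j)%N ->
      birth v <= cs`_i -> alive v j = 0.
    move=> lti ltj leij leb; rewrite /alive dE /= ltNge.
    by rewrite (le_trans leb) ?le_cs.
  have unborn i : (i < size cs)%N -> ~~ (birth v <= cs`_i) ->
      born v i - bornP v i = 0.
    move=> lti Nb; rewrite /born (negPf Nb); case: i lti Nb => [|i] lti Nb /=.
      by rewrite subr0.
    rewrite /born; case: (boolP (_ <= _)) => [leb|]; rewrite ?subr0 //.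
    by case/negP: Nb; apply: le_trans leb _; rewrite le_cs ?(ltnW lti).
  rewrite !big1 ?addr0 // => i _.
    case: ifP => // _; have [leb|/unborn ->] := boolP (birth v <= cs`_i).
    - have lei : (i <= (size cs).-1)%N by rewrite -ltnS (ltn_predK (ltn_ord i)).
      by rewrite (dead i) ?mulr0 // (ltn_predK (ltn_ord i)).
    - by rewrite mul0r.
    - by [].
  rewrite big1 // => j ltij; case: ifP => // _.
  have [leb|/unborn ->] := boolP (birth v <= cs`_i); rewrite ?mul0r //.
  have j_gt0 : (0 < j)%N by apply: leq_ltn_trans ltij.
  have lej : (i <= j.-1)%N by rewrite -ltnS prednK.
  rewrite (dead i) ?(dead i j) ?subrr ?mulr0 ?(ltnW ltij) //.
  by rewrite (leq_ltn_trans (leq_pred j)).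
have bS i : (i < size cs)%N -> born v i - bornP v i = (i == b)%:R.
  by move=> lti; apply: born_step.
pose ob := Ordinal ltb.
case dE: (death v) dP => [d|] dP; last first.
  (* Infinite bar: [alive] is constantly 1, so its differences vanish and only the infinite term at
     the birth index remains. *)
  rewrite big1 ?add0r => [|i _]; last first.
    by rewrite big1 // => j _; rewrite /alive dE subrr mulr0 if_same.
  rewrite (bigD1 ob) //= bS // eqxx bE andbT big1 => [|i Ni].
    by rewrite addr0 /alive dE mulr1; case: ifP.
  by rewrite bS // (negPf (Ni : (i : nat) != b)) mul0r if_same.
case: dP => /(nthP 0)[d' ltd d'E]; rewrite -{}d'E in dE *.
rewrite -bE lt_cs // => ltbd.
(* Finite bar: its death index is at most the last one, so it contributes nothing to the infinite
   part. *)
have last_dead : alive v (size cs).-1 = 0.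
  rewrite /alive dE /= lt_cs ?(ltn_predK ltd) //.
  by rewrite leqNgt ltd.
rewrite [X in _ + X]big1 ?addr0 => [|i _]; last first.
  by rewrite last_dead mulr0 if_same.
rewrite (bigD1 ob) //= [X in _ + X]big1 ?addr0 => [|i Ni]; last first.
  apply: big1 => j _.
  by rewrite bS // (negPf (Ni : (i : nat) != b)) mul0r if_same.
have aS j : (b < j < size cs)%N -> alive v j.-1 - alive v j = (j == d')%:R.
  case/andP=> ltbj ltj; apply: alive_step => //.
  by rewrite ltj (leq_ltn_trans _ ltbj).
rewrite (bigD1 (Ordinal ltd)) //= bS // aS ?ltbd // !eqxx mulr1.
rewrite big1 ?addr0 => [|j /andP[ltbj Nj]]; last first.
  by rewrite aS ?ltbj //= (negPf (Nj : (j : nat) != d')) mulr0 if_same.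
have -> : Some cs`_d' != Some cs`_b.
  by apply/eqP => -[] /eqP; rewrite eq_sym lt_eqF ?lt_cs.
by rewrite andbT; case: ifP.
Qed.

Lemma pd_mult_bars p : pd_mult e F f p =
  #|[pred v | (p == (birth v, death v)) && (death v != Some (birth v))]|%:Z.
Proof.
have sum_if (c : bool) (X : V -> int) :
    (if c then \sum_v X v else 0) = \sum_v if c then X v else 0.
  by case: c => //; rewrite big1.
transitivity (\sum_v bar_contribution v p); last first.
  rewrite -natz -sum1_card natr_sum [RHS]big_mkcond; apply: eq_bigr => v _.
  by rewrite bar_contributionE inE; case: (_ && _).
rewrite /bar_contribution big_split /=; congr (_ + _).
  rewrite [RHS]exchange_big; apply: eq_bigr => i _.
  rewrite [RHS]exchange_big; apply: eq_bigr => j _.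
  by rewrite pmult_sum sum_if.
rewrite [RHS]exchange_big; apply: eq_bigr => i _.
by rewrite pmult_inf_sum sum_if.
Qed.

End DiagramFromBars.

(** * The values assigned to vertices and edges, as functions of the index *)

Section Levels.
Variables (R : realFieldType) (N : nat) (L : seq (nat * nat)).
Hypothesis N_gt0 : (0 < N)%N.
Hypothesis L_sorted : sorted leq (unzip1 L).
Hypothesis L_uniq : uniq (unzip1 L ++ unzip2 L).
Hypothesis L_range : forall p, p \in L -> [&& 0 < p.1, p.1 < p.2 & p.2 <= N]%N.

(* The values taken on non-critical pairs: increasing, and lying strictly
   between the consecutive integers N - 1 and N. *)
Definition late (i : nat) : R := N%:R - (i.+2%:R)^-1.

(** The entry prepended at index 0 gives the root the value 0 and puts the finite bars of [L] at
    indices 1 to [size L]. *)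
Definition vnat (i : nat) : nat := (nth (0, 0)%N ((0, 0)%N :: L) i).1.
Definition enat (i : nat) : nat := (nth (0, 0)%N ((0, 0)%N :: L) i).2.
Definition vlevel (i : nat) : R := if (i <= size L)%N then (vnat i)%:R else late i.
Definition elevel (i : nat) : R := if (i <= size L)%N then (enat i)%:R else late i.

Lemma late_lt i j : (i < j)%N -> late i < late j.
Proof.
by move=> ltij; rewrite ltrD2l ltrN2 ltf_pV2 ?posrE ?ltr0n // ltr_nat !ltnS.
Qed.

Lemma late_ltN i : late i < N%:R.
Proof. by rewrite ltrBlDr ltrDl invr_gt0 ltr0n. Qed.

Lemma late_gtN i : N.-1%:R < late i.
Proof.
rewrite ltrBrDr -[X in _ < X%:R](prednK N_gt0) -[X in _ < X]natr1 ltrD2l.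
by rewrite invf_lt1 ?ltr0n // ltr1n.
Qed.

Lemma late_neq_nat i k : late i <> k%:R.
Proof.
move=> lk; have := late_ltN i; have := late_gtN i.
by rewrite lk !ltr_nat -{2}(prednK N_gt0) ltnS => /leq_trans h /h; rewrite ltnn.
Qed.

Lemma vnat_enat i : (0 < i <= size L)%N ->
  [&& 0 < vnat i, vnat i < enat i & enat i <= N]%N.
Proof. by case: i => // i lti; apply/L_range/mem_nth. Qed.

Lemma vnat_nth i : vnat i = nth 0%N (0%N :: unzip1 L) i.
Proof.
rewrite -[_ :: _]/(unzip1 ((0, 0)%N :: L)) /vnat.
have [lti|lti] := ltnP i (size ((0, 0)%N :: L)).
  by rewrite (nth_map (0, 0)%N).
by rewrite !nth_default ?size_map.
Qed.

Lemma vnat_lt i j : (i < j)%N -> (j <= size L)%N -> (vnat i < vnat j)%N.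
Proof.
move=> ltij ltj; rewrite !vnat_nth.
have srt : sorted ltn (0%N :: unzip1 L).
  rewrite /= path_min_sorted; last first.
    by apply/allP => _ /mapP[p /L_range/and3P[p1 _ _] ->].
  by rewrite ltn_sorted_uniq_leq L_sorted; move: L_uniq; rewrite cat_uniq => /andP[->].
apply: (sorted_ltn_nth ltn_trans 0%N srt) => //; rewrite inE /= size_map ltnS //.
exact: leq_trans (ltnW ltij) ltj.
Qed.

Lemma enat_inj i j : (0 < i <= size L)%N -> (0 < j <= size L)%N ->
  enat i = enat j -> i = j.
Proof.
case: i j => // i [] // j /= lti ltj.
rewrite /enat /= -!(nth_map _ 0%N snd) // => /eqP; rewrite nth_uniq ?size_map //.
  by move/eqP ->.
by move: L_uniq; rewrite cat_uniq => /and3P[].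
Qed.

Lemma vnat_neq_enat i j : (i <= size L)%N -> (0 < j <= size L)%N ->
  vnat i <> enat j.
Proof.
case: i => [|i] lti ltj.
  by have /and3P[_ + _] := vnat_enat ltj; case: (enat j).
case: j ltj => // j ltj; rewrite /vnat /enat /= => vE.
move: L_uniq; rewrite cat_uniq => /and3P[_ /hasPn/(_ (nth (0, 0)%N L j).2) + _].
rewrite map_f ?mem_nth // -vE => /(_ isT); rewrite /= map_f //.
exact: mem_nth.
Qed.

Lemma vnat_ltN i : (i <= size L)%N -> (vnat i < N)%N.
Proof.
case: i => // i lti; have /and3P[_ + +] := @vnat_enat i.+1 lti.
exact: leq_trans.
Qed.

(** Each birth precedes a death that is at most [N], so births are at most [N - 1] and lie below all
    [late] values. Edges admit no such ordering, since a death may equal [N]. *)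
Lemma vlevel_lt i j : (i < j)%N -> vlevel i < vlevel j.
Proof.
move=> ltij; rewrite /vlevel; have [ltj|ltj] := leqP j.
  by rewrite (leq_trans (ltnW ltij) ltj) ltr_nat vnat_lt.
case: leqP => [lti|_]; last exact: late_lt.
apply: le_lt_trans (late_gtN j); rewrite ler_nat -ltnS prednK //.
exact: vnat_ltN.
Qed.

Lemma vlevel0 : vlevel 0 = 0.
Proof. by []. Qed.

Lemma vlevel_inj : injective vlevel.
Proof.
by move=> i j vE; case: (ltngtP i j) => // /vlevel_lt; rewrite vE ltxx.
Qed.

Lemma vlevel_elevel i : (0 < i <= size L)%N -> vlevel i < elevel i.
Proof.
move=> lti; have /andP[_ li] := lti; rewrite /vlevel /elevel li ltr_nat.
by have /and3P[] := vnat_enat lti.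
Qed.

Lemma vlevel_late i : (size L < i)%N -> vlevel i = elevel i.
Proof. by move=> lti; rewrite /vlevel /elevel leqNgt lti. Qed.

Lemma vlevel_le_elevel i : (0 < i)%N -> vlevel i <= elevel i.
Proof.
move=> i_gt0; have [lti|lti] := leqP i (size L); last by rewrite vlevel_late.
by rewrite ltW // vlevel_elevel // i_gt0.
Qed.

Lemma elevel_inj i j : (0 < i)%N -> (0 < j)%N -> elevel i = elevel j -> i = j.
Proof.
move=> i_gt0 j_gt0; rewrite /elevel; have [lti|lti] := leqP i; have [ltj|ltj] := leqP j.
- by move/eqP; rewrite eqr_nat => /eqP/enat_inj -> //; apply/andP.
- by move/esym/late_neq_nat.
- by move/late_neq_nat.
- by case: (ltngtP i j) => // /late_lt + lE; rewrite lE ltxx.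
Qed.

(** Births and deaths are distinct integers and [late] values are never integers, so a vertex and an
    edge can agree only in the late range. *)
Lemma vlevel_eq_elevel i j : (0 < j)%N -> vlevel i = elevel j ->
  i = j /\ (size L < j)%N.
Proof.
move=> j_gt0; have [ltj|ltj] := leqP j (size L).
  rewrite /elevel ltj /vlevel; have [lti|lti] := leqP i.
    by move/eqP; rewrite eqr_nat => /eqP/vnat_neq_enat []//; apply/andP.
  by move/late_neq_nat.
by rewrite -vlevel_late // => /vlevel_inj ->.
Qed.

Lemma vlevel_ge0 i : 0 <= vlevel i.
Proof. by case: i => // i; rewrite -vlevel0 ltW // vlevel_lt. Qed.

Lemma elevel_leN i : (0 < i)%N -> elevel i <= N%:R.
Proof.
move=> i_gt0; rewrite /elevel; case: leqP => [lti|_]; last exact/ltW/late_ltN.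
have /vnat_enat/and3P[_ _ +] : (0 < i <= size L)%N by rewrite i_gt0.
by rewrite ler_nat.
Qed.

Lemma vlevel_leN i : vlevel i <= N%:R.
Proof.
case: i => [|i]; first by rewrite ler0n.
exact: le_trans (vlevel_le_elevel (ltn0Sn i)) (elevel_leN (ltn0Sn i)).
Qed.

End Levels.

(** * The simplices of a rooted tree and the Morse function on them *)

Section RootedSimplices.
Variables (V : finType) (e : rel V) (idx : V -> nat) (par : V -> V).
Hypothesis e_sym : symmetric e.
Hypothesis e_irr : irreflexive e.
Hypothesis idx_inj : injective idx.
Hypothesis idx_lt : forall v, (idx v < #|V|)%N.
Hypothesis e_par : forall v, (0 < idx v)%N -> e v (par v).
Hypothesis ltn_par : forall v, (0 < idx v)%N -> (idx (par v) < idx v)%N.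
Hypothesis par_uniq : forall x y, e x y -> (idx y < idx x)%N -> y = par x.

Definition edge (v : V) : V + {set V} := inr [set v; par v].
(** On an edge this recovers the index of the later endpoint from the bare set, which lets edges be
    valued by index. *)
Definition top (A : {set V}) : nat := \max_(v in A) idx v.

Lemma top_edge v : (0 < idx v)%N -> top [set v; par v] = idx v.
Proof.
move=> v_gt0; rewrite /top big_setU1 /= ?big_set1; last first.
  by rewrite inE; apply: contraTneq (ltn_par v_gt0) => <-; rewrite ltnn.
by apply/maxn_idPl/ltnW/ltn_par.
Qed.

Variant simplex_spec : V + {set V} -> Prop :=
  | SimplexVertex v : simplex_spec (inl v)
  | SimplexEdge v of (0 < idx v)%N : simplex_spec (edge v).

Lemma simplexP s : simplex e s -> simplex_spec s.
Proof.
case: s => [v _|A /existsP[x /existsP[y /andP[exy /eqP ->]]]]; first exact: SimplexVertex.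
case: (ltngtP (idx x) (idx y)) => [ltxy|ltyx|/idx_inj xy].
- rewrite setUC (par_uniq _ ltxy) 1?e_sym //; apply: SimplexEdge.
  exact: leq_ltn_trans ltxy.
- rewrite (par_uniq exy ltyx); apply: SimplexEdge.
  exact: leq_ltn_trans ltyx.
- by rewrite xy e_irr in exy.
Qed.

Lemma simplex_edge v : (0 < idx v)%N -> simplex e (edge v).
Proof.
by move=> v_gt0; apply/existsP; exists v; apply/existsP; exists (par v); rewrite e_par ?eqxx.
Qed.

Lemma edge_inj v w : (0 < idx v)%N -> (0 < idx w)%N -> edge v = edge w -> v = w.
Proof.
move=> v_gt0 w_gt0 [vw]; apply: idx_inj.
by rewrite -(top_edge v_gt0) vw top_edge.
Qed.

(** This bound, combined with [size_finite_bars], leaves enough vertices to host all bars. *)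
Lemma nsimp_lt : (0 < #|V|)%N -> (nsimp e < #|V|.*2)%N.
Proof.
move=> V_gt0.
(* Vertices get the even codes [2 * idx v], edges the odd codes [2 * idx v - 1] of their later
   endpoints; all are below [2 * #|V| - 1]. *)
pose code s := match s with inl v => (idx v).*2 | inr A => (top A).*2.-1 end.
have code_edge v : (0 < idx v)%N -> (code (edge v)).+1 = (idx v).*2.
  by move=> v_gt0; rewrite /= top_edge // prednK ?double_gt0.
have code_inj : {in enum [pred s | simplex e s] &, injective code}.
  move=> s t; rewrite !mem_enum !inE => /simplexP[u|u u_gt0] /simplexP[v|v v_gt0].
  - by move/double_inj/idx_inj ->.
  - by move/(congr1 S); rewrite code_edge // => /(congr1 odd); rewrite /= !odd_double.
  - by move/(congr1 S); rewrite code_edge // => /(congr1 odd); rewrite /= !odd_double.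
  - by move/(congr1 S); rewrite !code_edge // => /double_inj/idx_inj ->.
have sub_code : {subset map code (enum [pred s | simplex e s]) <= iota 0 #|V|.*2.-1}.
  move=> _ /mapP[s + ->]; rewrite mem_enum mem_iota leq0n add0n.
  rewrite -[(_ < _)%N]ltnS prednK ?double_gt0 //.
  case/simplexP => [v|v v_gt0]; first by rewrite /= -doubleS leq_double.
  by rewrite code_edge //= ltn_double idx_lt.
have := uniq_leq_size _ sub_code.
rewrite map_inj_in_uniq ?enum_uniq // size_map size_iota -cardE => /(_ isT).
by rewrite -ltnS prednK ?double_gt0.
Qed.

(** An injection of [V] into the numbers below [#|V|] is a bijection, so counting vertices becomes
    counting indices. *)
Lemma count_idx (P : pred nat) (k : nat) : (k < #|V|)%N ->
  #|[pred v | (idx v <= k)%N && P (idx v)]| = count P (iota 0 k.+1).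
Proof.
move=> ltk; have perm_idx : perm_eq [seq idx v | v <- enum V] (iota 0 #|V|).
  have u1 : uniq [seq idx v | v <- enum V] by rewrite map_inj_uniq ?enum_uniq.
  have sub1 : {subset [seq idx v | v <- enum V] <= iota 0 #|V|}.
    by move=> _ /mapP[v _ ->]; rewrite mem_iota idx_lt.
  have [|_ m] := uniq_min_size u1 sub1; first by rewrite size_iota size_map -cardE.
  exact: uniq_perm u1 (iota_uniq _ _) m.
transitivity (count (fun i => (i <= k)%N && P i) (iota 0 #|V|)).
  by rewrite -(permP perm_idx) count_map enumT cardE /enum_mem size_filter.
rewrite -(subnKC ltk) iotaD count_cat add0n [X in (_ + X)%N](_ : _ = 0%N) ?addn0.
  by apply: eq_in_count => i; rewrite mem_iota ltnS => /= ->.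
apply/eqP; rewrite -leqn0 leqNgt -has_count; apply/hasPn => i.
by rewrite mem_iota => /andP[lti _]; rewrite negb_and -ltnNge lti.
Qed.

Lemma idx0_ex : (0 < #|V|)%N -> exists v, idx v = 0%N.
Proof.
move/(count_idx predT) => c1; have /card_gt0P[v] : (0 < #|[pred v | (idx v <= 0)%N && true]|)%N.
  by rewrite c1.
by rewrite inE andbT leqn0 => /eqP; exists v.
Qed.

Variables (R : realFieldType) (N : nat) (L : seq (nat * nat)).
Hypothesis N_gt0 : (0 < N)%N.
Hypothesis L_sorted : sorted leq (unzip1 L).
Hypothesis L_uniq : uniq (unzip1 L ++ unzip2 L).
Hypothesis L_range : forall p, p \in L -> [&& 0 < p.1, p.1 < p.2 & p.2 <= N]%N.

Definition level_fun (s : V + {set V}) : R :=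
  match s with
  | inl v => vlevel R N L (idx v)
  | inr A => elevel R N L (top A)
  end.

Lemma level_edge v : (0 < idx v)%N -> level_fun (edge v) = elevel R N L (idx v).
Proof. by move=> v_gt0; rewrite /level_fun /edge top_edge. Qed.

(** Values are injective on vertices and on edges separately, so only a late vertex and its parent
    edge can collide. The pairing conditions and the list of critical simplices both follow from
    this. *)
Lemma level_fun_collision s t : simplex e s -> simplex e t -> s != t ->
  level_fun s = level_fun t -> exists2 v, (size L < idx v)%N &
  (s = inl v /\ t = edge v) \/ (s = edge v /\ t = inl v).
Proof.
move=> /simplexP[u|u u_gt0] /simplexP[v|v v_gt0] sNt;
  rewrite ?level_edge //.
- by move/(vlevel_inj N_gt0 L_sorted L_uniq L_range)/idx_inj => uv; rewrite uv eqxx in sNt.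
- move/(vlevel_eq_elevel N_gt0 L_sorted L_uniq L_range v_gt0) => [/idx_inj -> ltL].
  by exists v => //; left.
- move/esym/(vlevel_eq_elevel N_gt0 L_sorted L_uniq L_range u_gt0) => [/idx_inj -> ltL].
  by exists u => //; right.
- by move/(elevel_inj N_gt0 L_uniq u_gt0 v_gt0)/idx_inj => uv; rewrite uv eqxx in sNt.
Qed.

Lemma critical_vertex v : (idx v <= size L)%N -> critical e level_fun (inl v).
Proof.
move=> lev; apply/andP; split=> //; apply/forallP => t; apply/implyP => st.
apply/implyP => /eqP tE; apply/negPn/negP => /level_fun_collision/(_ tE) h.
by case: (h st isT) => w ltw [[_ //]|[_ [vw]]]; rewrite leqNgt vw ltw in lev.
Qed.

Lemma critical_edge v : (0 < idx v <= size L)%N -> critical e level_fun (edge v).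
Proof.
case/andP=> v_gt0 lev; have sv := simplex_edge v_gt0.
apply/andP; split=> //; apply/forallP => t; apply/implyP => st.
apply/implyP => /eqP tE; apply/negPn/negP => Nts.
have [w ltw [[_ vw]|[_ //]]] := level_fun_collision st sv Nts tE.
have : top [set v; par v] = top [set w; par w] by case: vw => ->.
by rewrite !top_edge ?(leq_ltn_trans _ ltw) // => vwE; rewrite leqNgt vwE ltw in lev.
Qed.

Lemma discrete_Morse_level_fun : (0 < #|V|)%N -> N = nsimp e -> discrete_Morse e level_fun.
Proof.
move=> V_gt0 NE; split.
- move=> _ /simplexP[v|v v_gt0]; rewrite -NE ?level_edge //.
    by rewrite /= vlevel_ge0 ?vlevel_leN.
  rewrite elevel_leN // andbT; apply: (@le_trans _ _ (vlevel R N L (idx v))).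
    exact: vlevel_ge0.
  exact: vlevel_le_elevel.
- move=> _ _ /simplexP[u|u u_gt0] /simplexP[v|v v_gt0] //=.
  rewrite top_edge // !inE => /orP[]/eqP ->; first exact: vlevel_le_elevel.
  apply: (@le_trans _ _ (vlevel R N L (idx v))); last exact: vlevel_le_elevel.
  by rewrite ltW // vlevel_lt // ltn_par.
- by have [v v0] := idx0_ex V_gt0; exists (inl v) => //=; rewrite v0.
- split.
    (* A collision pairs [t] with one determined partner, so two collisions force [s = u]. *)
    move=> s t u ss st su st' tu su' [fst ftu].
    have [v ltv H] := level_fun_collision ss st st' fst.
    have [w ltw H'] := level_fun_collision st su tu ftu.
    case: H H' => -[sE ->] [] [tE uE] //; move: su'; rewrite sE uE.
      rewrite (edge_inj _ _ tE) ?eqxx //; first exact: leq_ltn_trans ltv.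
      exact: leq_ltn_trans ltw.
    by case: tE => ->; rewrite eqxx.
  move=> s t ss st st' fst.
  have [v _ [[-> ->]|[-> ->]]] := level_fun_collision ss st st' fst.
    by rewrite /= !inE eqxx.
  by rewrite /= !inE eqxx.
- move=> s crit_s; have /andP[ss /forallP uniq_s] := crit_s.
  (* A late simplex shares its value with its partner and is not critical; the remaining simplices
     have natural values. *)
  have critN v : (size L < idx v)%N -> s = inl v \/ s = edge v -> False.
    move=> ltv; have v_gt0 : (0 < idx v)%N by apply: leq_ltn_trans ltv.
    have ve : level_fun (inl v) = level_fun (edge v).
      by rewrite level_edge // -vlevel_late.
    case=> sE; [have := uniq_s (edge v)|have := uniq_s (inl v)];
      by rewrite sE ?simplex_edge //= -/(level_fun (inl v)) -/(level_fun (edge v)) ve eqxx.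
  case/simplexP: ss critN => [v|v v_gt0] critN.
    have [lev|/critN[]] := leqP (idx v) (size L); last by left.
    by exists (vnat L (idx v)); rewrite /= /vlevel lev.
  have [lev|/critN[]] := leqP (idx v) (size L); last by right.
  by exists (enat L (idx v)); rewrite level_edge // /elevel lev.
Qed.

Variable F : fieldType.

Definition bar (i : nat) : R * option R :=
  (vlevel R N L i, if (0 < i)%N then Some (elevel R N L i) else None).

Lemma crit_values_level_fun : sorted <%R (crit_values e level_fun).
Proof.
rewrite lt_sorted_uniq_le sort_le_sorted andbT sort_uniq map_inj_in_uniq ?enum_uniq //.
move=> s t; rewrite !mem_enum => /andP[ss _] /andP[_ /forallP/(_ s)].
by rewrite ss /= => h fE; apply/eqP; move: h; rewrite fE eqxx.
Qed.

Lemma mem_crit_values s : critical e level_fun s ->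
  level_fun s \in crit_values e level_fun.
Proof. by move=> cs; rewrite mem_sort map_f // mem_enum. Qed.

(** Vertices of index above [size L] carry bars of length zero and drop out; each remaining vertex
    contributes [bar] at its index. *)
Lemma pd_mult_level_fun p : (size L < #|V|)%N ->
  pd_mult e F level_fun p = (count (fun i => p == bar i) (iota 0 (size L).+1))%:Z.
Proof.
move=> ltL; pose birth v := vlevel R N L (idx v); pose death v := (bar (idx v)).2.
rewrite (@pd_mult_bars _ _ _ _ _ birth death) => [||i j|v].
- rewrite -(count_idx _ ltL); congr Posz; apply: eq_card => v; rewrite !inE /=.
  rewrite -[(birth v, death v)]/(bar (idx v)) andbC; congr (_ && _).
  rewrite /death /birth /=; case: posnP => [->//|v_gt0].
  have [lev|ltv] := leqP (idx v) (size L); last by rewrite vlevel_late ?eqxx.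
  apply/eqP => -[] eqv; have := @vlevel_elevel R N L L_range (idx v).
  by rewrite v_gt0 lev eqv ltxx => /(_ isT).
- exact: crit_values_level_fun.
- rewrite /betaI (@pbetti_rooted _ idx par) //; last first.
    by move=> v v_gt0; rewrite ltW // vlevel_lt // ltn_par.
  congr Posz; apply: eq_card => v; rewrite !inE /=; congr (_ && _).
  rewrite /death /bar /=; case: posnP => //= v_gt0.
  by rewrite top_edge // ltNge.
- rewrite /death /birth /bar /=; have [lev|ltv] := leqP (idx v) (size L); last first.
    by left; rewrite (leq_ltn_trans _ ltv) // vlevel_late.
  right; split; first exact: (mem_crit_values (critical_vertex lev)).
  case: posnP => // v_gt0; split; last by rewrite vlevel_elevel ?v_gt0.
  by rewrite -level_edge //; apply/mem_crit_values/critical_edge/andP.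
Qed.

End RootedSimplices.

(** * The finite bars of a consistent diagram *)

Definition finite_bars (D : seq (nat * option nat)) : seq (nat * nat) :=
  sort (fun p q => p.1 <= q.1)%N
    [seq (p.1, odflt 0%N p.2) | p <- D & p != (0%N, None)].

Section FiniteBars.
Variables (N : nat) (D : seq (nat * option nat)).
Hypothesis hD : consistent N D.

Lemma perm_finite_bars : perm_eq (finite_bars D)
  [seq (p.1, odflt 0%N p.2) | p <- D & p != (0%N, None)].
Proof. by rewrite perm_sort. Qed.

Lemma finite_bars_sorted : sorted leq (unzip1 (finite_bars D)).
Proof. by rewrite sorted_map; apply: sort_sorted => p q; apply: leq_total. Qed.

Lemma finite_bars_range p :
  p \in finite_bars D -> [&& 0 < p.1, p.1 < p.2 & p.2 <= N]%N.
Proof.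
rewrite (perm_mem perm_finite_bars) => /mapP[q].
rewrite mem_filter => /andP[Nq qD] ->; case: hD => _ _ /(_ q qD Nq) + _.
by case=> d /= -> [-> -> ->].
Qed.

Lemma finite_bars_uniq : uniq (unzip1 (finite_bars D) ++ unzip2 (finite_bars D)).
Proof.
(* Consistency lists the endpoints bar by bar; here they are regrouped into all births, then all
   deaths. *)
have perm2 (s : seq (nat * nat)) :
    perm_eq (unzip1 s ++ unzip2 s) (flatten [seq [:: p.1; p.2] | p <- s]).
  elim: s => // p s IH /=; rewrite perm_cons -cat1s perm_catCA /= perm_cons.
  exact: IH.
rewrite (perm_uniq (perm2 _)) (perm_uniq (perm_flatten (perm_map _ perm_finite_bars))).
by rewrite -map_comp; case: hD.
Qed.

(** The endpoints of the bars are pairwise distinct integers between 1 and [N], two for each bar. *)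
Lemma size_finite_bars : ((size (finite_bars D)).*2 <= N)%N.
Proof.
have sub : {subset unzip1 (finite_bars D) ++ unzip2 (finite_bars D) <= iota 1 N}.
  move=> x; rewrite mem_cat mem_iota add1n ltnS.
  case/orP=> /mapP[p /finite_bars_range/and3P[p1 p12 p2] ->].
    by rewrite p1 (leq_trans (ltnW p12)).
  by rewrite p2 (leq_trans p1 (ltnW p12)).
have := uniq_leq_size finite_bars_uniq sub.
by rewrite size_cat !size_map size_iota addnn.
Qed.

(** As [D] has no repetition, removing its one infinite pair leaves exactly the finite bars. *)
Lemma perm_diag_to_R (R : realFieldType) : perm_eq (diag_to_R R D)
  ((0, None) :: [seq (p.1%:R, Some p.2%:R) | p <- finite_bars D]).
Proof.
have [D0 uD rangeD _] := hD.
have permD : perm_eq D ((0%N, None) :: [seq p <- D | p != (0%N, None)]).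
  by rewrite -[X in perm_eq _ (_ :: X)]/(filter (predC1 _) D) -rem_filter // perm_to_rem.
apply: perm_trans (perm_map _ permD) _; rewrite /= perm_cons.
rewrite perm_sym; apply: perm_trans (perm_map _ perm_finite_bars) _.
rewrite -map_comp; apply: (etrans _ (perm_refl _)); congr (perm_eq _ _).
apply/eq_in_map => q; rewrite mem_filter => /andP[Nq qD].
by have [d /= -> _] := rangeD q qD Nq.
Qed.

End FiniteBars.

(** * Realising the diagram *)

Theorem theorem4p8 (V : finType) (e : rel V) (hT : is_tree e)
    (D : seq (nat * option nat)) (hD : consistent (nsimp e) D)
    (F : fieldType) (R : realFieldType) :
  exists f : V + {set V} -> R,
    discrete_Morse e f /\
    forall p : R * option R,
      pd_mult e F f p = (count_mem p (diag_to_R R D))%:Z.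
Proof.
have [[e_sym e_irr] V_gt0 _ _] := hT.
have [idx [par [idx_inj idx_lt parP par_uniq]]] := tree_order hT.
have e_par v : (0 < idx v)%N -> e v (par v) by case/parP.
have ltn_par v : (0 < idx v)%N -> (idx (par v) < idx v)%N by case/parP.
have N_gt0 : (0 < nsimp e)%N.
  by have /card_gt0P[v _] := V_gt0; apply/card_gt0P; exists (inl v).
have L_sorted := finite_bars_sorted D.
have L_range := finite_bars_range hD.
have L_uniq := finite_bars_uniq hD.
exists (level_fun idx R (nsimp e) (finite_bars D)); split.
  exact: (@discrete_Morse_level_fun _ _ _ par).
(* With [k] finite bars, [2k <= nsimp e < 2 * #|V|]. *)
have ltL : (size (finite_bars D) < #|V|)%N.
  rewrite -ltn_double; apply: leq_ltn_trans (size_finite_bars hD) _.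
  exact: (@nsimp_lt _ _ idx par).
move=> p; rewrite (@pd_mult_level_fun _ _ _ par) //.
rewrite (permP (perm_diag_to_R hD R)); congr Posz.
set L := finite_bars D.
(* Index 0 is the root with its infinite bar; index [i > 0] is the [i]-th finite bar in order of
   birth. *)
have -> : (0, None) :: [seq (q.1%:R, Some q.2%:R) | q <- L] =
    [seq bar R (nsimp e) L i | i <- iota 0 (size L).+1].
  apply: (@eq_from_nth _ (0, None)) => [|i]; rewrite /= !size_map ?size_iota //.
  case: i => [|i] //; rewrite ltnS => lti.
  rewrite /= (nth_map (0, 0)%N) // (nth_map 0%N) ?size_iota //.
  by rewrite nth_iota // /bar /vlevel /elevel add1n lti.
by rewrite count_map; apply: eq_count => i /=; rewrite eq_sym.
Qed.
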